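(* Let $\mathcal{P}$ be a locally univalent circle packing of the hexagonal triangulation $\mathcal{T}_H=(H,E_H,F_H)$ in the complex plane $\mathbb{C}$, with radii $r_{m,n}$, and let $u=(u_{m,n})_{m,n\in\mathbb{Z}}$, $u_{m,n}=\ln r_{m,n}$. Let $D_1u_{m,n}=u_{m+1,n}-u_{m,n}$. For $v\sim w$ in $H$ define $$\eta_{vw}=\sum_{T\in F_{v,w}}\int_0^1\frac{\partial\theta_v}{\partial u_w}(f_T(t))\,\mathrm{d}t .$$ Then $D_1u$ is a discrete harmonic function on the weighted graph $(\mathcal{G}_H,\eta)$, where $\mathcal{G}_H=(H,E_H)$; that is, $$\sum_{w\sim v}\eta_{vw}(D_1u_w-D_1u_v)=0\quad\text{for all } v\in H.$$ Moreover, $\eta_{vw}=\eta_{wv}>0$ and $\eta_{vw}<2$ for all $v\sim w$.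
   Context: The hexagonal triangulation $\mathcal{T}_H=(H,E_H,F_H)$ of $\mathbb{C}$ has vertex set $H=\{v_{m,n}=m+ne^{\pi i/3}: m,n\in\mathbb{Z}\}$; two vertices $v,w\in H$ are joined by an edge (written $v\sim w$) iff $|v-w|=1$; faces are the triples of pairwise adjacent vertices, oriented as in $\mathbb{C}$. For an edge $\{v,w\}$, $F_{v,w}$ is the set of the two faces containing $\{v,w\}$. For a function $g$ on $H$ write $g_{m,n}=g_{v_{m,n}}$. A circle packing of $\mathcal{T}_H$ in $\mathbb{C}$ is a family of circles $\{C_v\}_{v\in H}$ in $\mathbb{C}$ (of positive radii; $r_{m,n}$ is the radius of the circle at $v_{m,n}$) such that (1) $C_v$ and $C_w$ are externally tangent whenever $\{v,w\}\in E_H$; (2) whenever $(v_1,v_2,v_3)$ is a positively oriented face, the triple $(C_{v_1},C_{v_2},C_{v_3})$ is positively oriented (the centers are in counterclockwise order). It is locally univalent if for every vertex $v$ the Euclidean triangles formed by the centers of the circles of the six faces containing $v$ have mutually disjoint interiors; in particular the inner angles of these triangles at the center of $C_v$ sum to $2\pi$. Angle functions: for a face $T=\{v_1,v_2,v_3\}$ and $(u_{v_1},u_{v_2},u_{v_3})\in\mathbb{R}^3$, consider the Euclidean triangle with side lengths $e^{u_{v_i}}+e^{u_{v_j}}$ between the vertices $v_i,v_j$ ($i\ne j$). $\theta_{v_i}(u_{v_1},u_{v_2},u_{v_3})$ is its inner angle at $v_i$, and $\frac{\partial\theta_v}{\partial u_w}$ denotes the partial derivative of this function on $\mathbb{R}^3$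 with respect to the coordinate $u_w$. Translation: $R(v_{m,n})=v_{m+1,n}$. For a face $T=\{v_1,v_2,v_3\}$ and $t\in[0,1]$, $$f_T(t)=\big(u_{v_i}+(u_{R(v_i)}-u_{v_i})t\big)_{i=1,2,3}\in\mathbb{R}^3,$$ where $u_{v}$ are the logarithms of the radii of $\mathcal{P}$. *)

(* Defs.v *)
From Stdlib Require Export Reals ZArith List.
From Stdlib Require Import Lia Lra Psatz.
From Coquelicot Require Export Coquelicot.
Import ListNotations.
Open Scope R_scope.

(** The pair [(m, n)] stands for the vertex v_{m,n} = m + n e^{pi i / 3}. *)
Definition vertex : Type := (Z * Z)%type.

Definition vertex_eq_dec (v w : vertex) : {v = w} + {v <> w}.
Proof. decide equality; apply Z.eq_dec. Defined.

Definition pos (v : vertex) : C :=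
  (RtoC (IZR (fst v)) + RtoC (IZR (snd v)) * (cos (PI / 3), sin (PI / 3)))%C.

Definition adj (v w : vertex) : Prop := Cmod (pos v - pos w)%C = 1.

(** Counterclockwise order: twice the signed area of the triangle is positive. *)
Definition ccw (p q s : C) : Prop :=
  0 < (fst q - fst p) * (snd s - snd p) - (snd q - snd p) * (fst s - fst p).

Definition face (v1 v2 v3 : vertex) : Prop :=
  adj v1 v2 /\ adj v2 v3 /\ adj v3 v1.

Definition positive_face (v1 v2 v3 : vertex) : Prop :=
  face v1 v2 v3 /\ ccw (pos v1) (pos v2) (pos v3).

(** An enumeration of the vertices adjacent to [v]; see [neighbors_spec]
    and [neighbors_NoDup]. *)
Definition neighbors (v : vertex) : list vertex :=
  let (m, n) := v in
  [(m + 1, n); (m, n + 1); (m - 1, n + 1);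
   (m - 1, n); (m, n - 1); (m + 1, n - 1)]%Z.

(** A face containing the edge {v, w} is determined by its third vertex, so
    the set F_{v,w} is encoded by the list of these third vertices; see
    [third_vertices_spec] and [third_vertices_NoDup]. *)
Definition third_vertices (v w : vertex) : list vertex :=
  filter (fun x => if in_dec vertex_eq_dec x (neighbors w) then true else false)
    (neighbors v).

Definition sum_over (l : list vertex) (f : vertex -> R) : R :=
  fold_right Rplus 0 (map f l).

Lemma adj_norm_form (v w : vertex) :
  adj v w <->
  let a := (fst v - fst w)%Z in let b := (snd v - snd w)%Z in
  (a * a + a * b + b * b = 1)%Z.
Proof.
  destruct v as [m n], w as [p q]; unfold adj, pos, Cmod; cbn [fst snd].
  rewrite cos_PI3, sin_PI3; cbn.
  match goal with |- sqrt ?e = 1 <-> _ => 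
    replace e with (IZR ((m - p) * (m - p) + (m - p) * (n - q) + (n - q) * (n - q))) end.
  2: { rewrite !plus_IZR, !mult_IZR, !minus_IZR.
       assert (Hs : sqrt 3 * sqrt 3 = 3) by (apply sqrt_sqrt; lra).
       apply Rminus_diag_uniq.
       match goal with |- ?d = 0 =>
         replace d with ((3 - sqrt 3 * sqrt 3) * ((IZR n - IZR q) * (IZR n - IZR q) / 4)) by field end.
       rewrite Hs; ring. }
  split; intros Hn.
  - apply eq_IZR; destruct (Rle_dec 0 (IZR ((m - p) * (m - p) + (m - p) * (n - q) + (n - q) * (n - q)))) as [h | h].
    + rewrite <- (sqrt_sqrt _ h), Hn; lra.
    + rewrite sqrt_neg_0 in Hn by lra; lra.
  - rewrite Hn; apply sqrt_1.
Qed.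

Lemma neighbors_spec (v w : vertex) : In w (neighbors v) <-> adj v w.
Proof.
  rewrite adj_norm_form; destruct v as [m n], w as [p q]; cbn; split.
  - intros [h|[h|[h|[h|[h|[h|[]]]]]]]; injection h; intros; subst; ring.
  - intros h.
    set (a := (m - p)%Z) in *; set (b := (n - q)%Z) in *.
    assert (ha : (-1 <= a <= 1)%Z) by nia.
    assert (hb : (-1 <= b <= 1)%Z) by nia.
    assert (hp : p = (m - a)%Z) by (unfold a; ring).
    assert (hq : q = (n - b)%Z) by (unfold b; ring).
    clearbody a b; subst p q.
    assert (Ha : (a = -1 \/ a = 0 \/ a = 1)%Z) by lia.
    assert (Hb : (b = -1 \/ b = 0 \/ b = 1)%Z) by lia.
    destruct Ha as [->|[->| ->]], Hb as [->|[->| ->]]; try lia;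
    repeat (first [left; f_equal; lia | right]).
Qed.

Lemma neighbors_NoDup (v : vertex) : NoDup (neighbors v).
Proof.
  destruct v as [m n]; cbn.
  repeat (constructor; [cbn; intros h;
    repeat (destruct h as [h|h]; [injection h; lia|]); exact h|]).
  constructor.
Qed.

Lemma third_vertices_spec (v w x : vertex) :
  adj v w -> (In x (third_vertices v w) <-> face v w x).
Proof.
  intros hvw; unfold third_vertices, face; rewrite filter_In, neighbors_spec.
  assert (hsym : adj v x <-> adj x v).
  { rewrite !adj_norm_form; cbn; split; intros h; rewrite <- h; ring. }
  destruct (in_dec vertex_eq_dec x (neighbors w)) as [i | i];
    rewrite neighbors_spec in i; intuition discriminate.
Qed.

Lemma third_vertices_NoDup (v w : vertex) : NoDup (third_vertices v w).
Proof. apply NoDup_filter, neighbors_NoDup. Qed.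

Record circle : Type := mkCircle {
  center : C;
  radius : R;
  radius_pos : 0 < radius
}.

Definition externally_tangent (A B : circle) : Prop :=
  Cmod (center A - center B)%C = radius A + radius B.

Definition circle_packing (P : vertex -> circle) : Prop :=
  (forall v w, adj v w -> externally_tangent (P v) (P w)) /\
  (forall v1 v2 v3, positive_face v1 v2 v3 ->
     ccw (center (P v1)) (center (P v2)) (center (P v3))).

Definition triangle (p q s : C) (z : C) : Prop :=
  exists a b c : R, 0 <= a /\ 0 <= b /\ 0 <= c /\ a + b + c = 1 /\
    z = (RtoC a * p + RtoC b * q + RtoC c * s)%C.

Definition interior (S : C -> Prop) (z : C) : Prop := locally z S.

(** Every face containing [v] has exactly one positively oriented listing
    starting with [v], so distinct faces at [v] correspond to distinct pairs
    [(x, y)]. *)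
Definition locally_univalent (P : vertex -> circle) : Prop :=
  forall v x y x' y' : vertex,
    positive_face v x y -> positive_face v x' y' -> (x, y) <> (x', y') ->
    forall z : C,
      ~ (interior (triangle (center (P v)) (center (P x)) (center (P y))) z /\
         interior (triangle (center (P v)) (center (P x')) (center (P y'))) z).

Definition log_radius (P : vertex -> circle) (v : vertex) : R :=
  ln (radius (P v)).

(** Inner angle between the sides of lengths [a] and [b] of a Euclidean
    triangle whose third side has length [c] (law of cosines). *)
Definition angle_of_sides (a b c : R) : R :=
  acos ((a ^ 2 + b ^ 2 - c ^ 2) / (2 * a * b)).

(** theta_{v_1}(u_{v_1}, u_{v_2}, u_{v_3}); the angle is always taken at the
    vertex carrying the first argument. *)
Definition theta (u1 u2 u3 : R) : R :=
  angle_of_sides (exp u1 + exp u2) (exp u1 + exp u3) (exp u2 + exp u3).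

(** Partial derivative of theta_{v_1} with respect to u_{v_2}. *)
Definition dtheta (u1 u2 u3 : R) : R := Derive (fun s => theta u1 s u3) u2.

Definition shift (v : vertex) : vertex := (fst v + 1, snd v)%Z.

Definition D1 (u : vertex -> R) (v : vertex) : R := u (shift v) - u v.

(** The component at the vertex [v] of the path f_T(t). *)
Definition path (u : vertex -> R) (t : R) (v : vertex) : R :=
  u v + (u (shift v) - u v) * t.

Definition eta (u : vertex -> R) (v w : vertex) : R :=
  sum_over (third_vertices v w) (fun x =>
    RInt (fun t => dtheta (path u t v) (path u t w) (path u t x)) 0 1).

Definition discrete_harmonic (weight : vertex -> vertex -> R) (g : vertex -> R) : Prop :=
  forall v, sum_over (neighbors v) (fun w => weight v w * (g w - g v)) = 0.

(* Main.v *)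
Require Import Defs.
From Stdlib Require Import Lia Lra Psatz Permutation.
Import ListNotations.
Open Scope R_scope.

(** With radii [x, y, z] and [s = x + y + z], the half-angle formula gives
    [theta_1 = 2 atan (sqrt (y z / (x s)))], whence
    [d theta_1 / d u_2 = sqrt (x y z / s) / (x + y)]: this is symmetric in the
    indices 1 and 2 and lies in (0, 1), and an edge has two faces.  For harmonicity, the six
    angles at a vertex sum to 2 pi, both at [v] and at its translate; the
    difference of the two sums is the integral over [0, 1] of the derivative of
    the angle sum along the paths [f_T], where [d theta_1 / d u_1] is minus the
    sum of the other two partial derivatives because [theta] is invariant under
    scaling of the triangle.

    The angle sum is a positive multiple of 2 pi because the sides around [v]
    close up.  If it exceeded 2 pi, some sector other than the first one would
    contain the directions slightly beyond 2 pi, which also lie in the first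
    sector; near the apex the two triangles would then overlap. *)

(** * Derivatives of the angle function *)

(** For radii x, y, z the triangle has semiperimeter s = x + y + z and inradius sqrt (x y z / s).
    The coupling is the inradius divided by the length x + y of the side joining the first two
    centers. *)
Definition coupling (u1 u2 u3 : R) : R :=
  sqrt (exp u1 * exp u2 * exp u3 / (exp u1 + exp u2 + exp u3)) / (exp u1 + exp u2).

Lemma coupling_sym (u1 u2 u3 : R) : coupling u1 u2 u3 = coupling u2 u1 u3.
Proof. unfold coupling; f_equal; [f_equal; f_equal |]; ring. Qed.

Lemma coupling_pos (u1 u2 u3 : R) : 0 < coupling u1 u2 u3.
Proof.
  unfold coupling.
  pose proof (exp_pos u1); pose proof (exp_pos u2); pose proof (exp_pos u3).
  apply Rdiv_lt_0_compat; [apply sqrt_lt_R0, Rdiv_lt_0_compat |]; try lra.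
  repeat apply Rmult_lt_0_compat; assumption.
Qed.

Lemma coupling_lt_1 (u1 u2 u3 : R) : coupling u1 u2 u3 < 1.
Proof.
  unfold coupling.
  pose proof (exp_pos u1) as hx; pose proof (exp_pos u2) as hy; pose proof (exp_pos u3) as hz.
  set (x := exp u1) in *; set (y := exp u2) in *; set (z := exp u3) in *.
  apply Rlt_div_l; [lra |].
  rewrite Rmult_1_l.
  (* The squared inradius satisfies x y z / s < x y <= (x + y)^2. *)
  apply Rlt_le_trans with (sqrt ((x + y) * (x + y))); [| rewrite sqrt_square; lra].
  assert (hxy : 0 < x * y) by (apply Rmult_lt_0_compat; assumption).
  apply sqrt_lt_1_alt; split.
  - apply Rlt_le, Rdiv_lt_0_compat; [apply Rmult_lt_0_compat |]; lra.
  - apply Rlt_div_l; [lra |].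
    assert (x * y * z < x * y * (x + y + z)) by (apply Rmult_lt_compat_l; lra).
    assert (x * y * (x + y + z) <= (x + y) * (x + y) * (x + y + z))
      by (apply Rmult_le_compat_r; nra).
    lra.
Qed.

(** The incircle touches the sides at the first center at distance x from it, so the tangent of the
    half-angle is the inradius over x. Twice the arctangent lies in (0, pi), where [acos] inverts
    [cos]; it remains to compare cosines, using cos (2 atan (sqrt q)) = 2 / (1 + q) - 1. *)
Lemma theta_atan (u1 u2 u3 : R) :
  theta u1 u2 u3 =
  2 * atan (sqrt (exp u2 * exp u3 / (exp u1 * (exp u1 + exp u2 + exp u3)))).
Proof.
  unfold theta, angle_of_sides.
  pose proof (exp_pos u1) as hx; pose proof (exp_pos u2) as hy; pose proof (exp_pos u3) as hz.
  set (x := exp u1) in *; set (y := exp u2) in *; set (z := exp u3) in *.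
  set (q := y * z / (x * (x + y + z))).
  assert (hq : 0 < q).
  { unfold q; apply Rdiv_lt_0_compat; apply Rmult_lt_0_compat; lra. }
  pose proof (atan_bound (sqrt q)) as hb.
  assert (hp : 0 < atan (sqrt q)).
  { rewrite <- atan_0; apply atan_increasing, sqrt_lt_R0, hq. }
  rewrite <- (acos_cos (2 * atan (sqrt q))) by lra.
  f_equal.
  rewrite cos_2a_cos, cos_atan.
  replace (Rsqr (sqrt q)) with q by (unfold Rsqr; rewrite sqrt_sqrt; lra).
  assert (hs : sqrt (1 + q) * sqrt (1 + q) = 1 + q) by (apply sqrt_sqrt; lra).
  assert (hs0 : 0 < sqrt (1 + q)) by (apply sqrt_lt_R0; lra).
  replace (2 * (1 / sqrt (1 + q)) * (1 / sqrt (1 + q)))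
    with (2 / (sqrt (1 + q) * sqrt (1 + q))) by (field; lra).
  rewrite hs; unfold q; field.
  assert (0 < x * (x + y + z)) by (apply Rmult_lt_0_compat; lra).
  assert (0 < y * z) by (apply Rmult_lt_0_compat; lra).
  repeat split; nra.
Qed.

(** A derivative along an arbitrary affine line serves both for the partial derivative and for the
    paths f_T. Only the differences d2 - d1 and d3 - d1 enter, which reflects the invariance under
    scaling. *)
Lemma is_derive_theta (a1 a2 a3 d1 d2 d3 t : R) :
  let u1 := a1 + d1 * t in let u2 := a2 + d2 * t in let u3 := a3 + d3 * t in
  is_derive (fun s => theta (a1 + d1 * s) (a2 + d2 * s) (a3 + d3 * s)) t
    (coupling u1 u2 u3 * (d2 - d1) + coupling u1 u3 u2 * (d3 - d1)).
Proof.
  intros u1 u2 u3.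
  pose proof (exp_pos u1) as hx; pose proof (exp_pos u2) as hy; pose proof (exp_pos u3) as hz.
  set (q := fun s => exp (a2 + d2 * s) * exp (a3 + d3 * s) /
     (exp (a1 + d1 * s) * (exp (a1 + d1 * s) + exp (a2 + d2 * s) + exp (a3 + d3 * s)))).
  apply (is_derive_ext (fun s => 2 * atan (sqrt (q s)))).
  { intros s; symmetry; apply theta_atan. }
  unfold coupling.
  set (x := exp u1) in *; set (y := exp u2) in *; set (z := exp u3) in *.
  assert (hD : 0 < x * (x + y + z)) by (apply Rmult_lt_0_compat; lra).
  assert (hN : 0 < y * z) by (apply Rmult_lt_0_compat; lra).
  assert (hqt : q t = y * z / (x * (x + y + z))) by reflexivity.
  assert (hq : 0 < q t).
  { rewrite hqt; apply Rdiv_lt_0_compat; assumption. }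
  (* [L] is the logarithmic derivative of [q] at [t]. *)
  set (L := (d2 + d3 - d1) - (x * d1 + y * d2 + z * d3) / (x + y + z)).
  assert (Dq : is_derive q t (q t * L)).
  { rewrite hqt; unfold q; auto_derive; fold u1 u2 u3; fold x y z.
    - lra.
    - unfold L; field; lra. }
  assert (hw : 0 < sqrt (q t)) by (apply sqrt_lt_R0; exact hq).
  assert (hw2 : sqrt (q t) * sqrt (q t) = q t) by (apply sqrt_sqrt; lra).
  assert (D2 : is_derive (fun p => 2 * atan (sqrt p)) (q t) (/ (sqrt (q t) * (1 + q t)))).
  { auto_derive; [exact hq |].
    rewrite Rmult_1_r, hw2; field; lra. }
  (* The inradius is x times the tangent of the half-angle. *)
  assert (hs : sqrt (x * y * z / (x + y + z)) = sqrt (q t) * x).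
  { transitivity (sqrt (q t) * sqrt (x * x)); [| rewrite sqrt_square; lra].
    rewrite <- sqrt_mult by nra.
    f_equal; rewrite hqt; field; lra. }
  replace (x * z * y / (x + z + y)) with (x * y * z / (x + y + z)) by (field; lra).
  rewrite hs.
  replace (sqrt (q t) * x / (x + y) * (d2 - d1) + sqrt (q t) * x / (x + z) * (d3 - d1))
    with (scal (q t * L) (/ (sqrt (q t) * (1 + q t)))).
  { exact (is_derive_comp (fun p => 2 * atan (sqrt p)) q t _ _ D2 Dq). }
  change (q t * L * / (sqrt (q t) * (1 + q t)) =
    sqrt (q t) * x / (x + y) * (d2 - d1) + sqrt (q t) * x / (x + z) * (d3 - d1)).
  (* After cancelling one factor [sqrt (q t)], the other stays as an atom and a rational identity
     remains, based on 1 + q = (x + y)(x + z) / (x (x + y + z)). *)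
  rewrite <- hw2 at 1.
  transitivity (sqrt (q t) * (L / (1 + q t))); [field; lra |].
  rewrite hqt at 2; unfold L; field; repeat split; nra.
Qed.

Lemma dtheta_coupling (u1 u2 u3 : R) : dtheta u1 u2 u3 = coupling u1 u2 u3.
Proof.
  unfold dtheta; apply is_derive_unique.
  apply (is_derive_ext (fun s => theta (u1 + 0 * s) (0 + 1 * s) (u3 + 0 * s))).
  { intros s; f_equal; ring. }
  pose proof (is_derive_theta u1 0 u3 0 1 0 u2) as h; cbv zeta in h.
  replace (u1 + 0 * u2) with u1 in h by ring.
  replace (0 + 1 * u2) with u2 in h by ring.
  replace (u3 + 0 * u2) with u3 in h by ring.
  replace (coupling u1 u2 u3) with
    (coupling u1 u2 u3 * (1 - 0) + coupling u1 u3 u2 * (0 - 0)) by ring.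
  exact h.
Qed.

(** * Integration along the paths f_T *)

Lemma continuous_coupling_path (u : vertex -> R) (v w x : vertex) (t : R) :
  continuous (fun t => coupling (path u t v) (path u t w) (path u t x)) t.
Proof.
  apply (ex_derive_continuous (V := R_NormedModule)); unfold coupling, path; auto_derive.
  pose proof (exp_pos (u v + (u (shift v) - u v) * t)) as hx.
  pose proof (exp_pos (u w + (u (shift w) - u w) * t)) as hy.
  pose proof (exp_pos (u x + (u (shift x) - u x) * t)) as hz.
  set (a := exp _) in hx; set (b := exp _) in hy; set (c := exp _) in hz.
  fold a b c.
  repeat split; try lra.
  apply Rdiv_lt_0_compat; [repeat apply Rmult_lt_0_compat |]; lra.
Qed.

(** The contribution of the face {v, w, x} to [eta u v w]. *)
Definition face_weight (u : vertex -> R) (v w x : vertex) : R :=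
  RInt (fun t => coupling (path u t v) (path u t w) (path u t x)) 0 1.

Lemma face_weight_sym (u : vertex -> R) (v w x : vertex) :
  face_weight u v w x = face_weight u w v x.
Proof. apply RInt_ext; intros; apply coupling_sym. Qed.

Lemma face_weight_bounds (u : vertex -> R) (v w x : vertex) :
  0 < face_weight u v w x < 1.
Proof.
  split.
  - apply RInt_gt_0; [lra | intros; apply coupling_pos |].
    intros; apply continuous_coupling_path.
  - apply Rlt_le_trans with (RInt (fun _ : R => 1) 0 1).
    2: { rewrite RInt_const; unfold scal; simpl; unfold mult; simpl; lra. }
    apply RInt_lt; [lra | | |].
    + intros; apply continuous_const.
    + intros; apply continuous_coupling_path.
    + intros; apply coupling_lt_1.
Qed.

(** The fundamental theorem of calculus along f_T, which runs from the face to its translate. The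
    slopes of the path are the constants [D1 u], so they factor out of the integrals. *)
Lemma theta_shift_sub (u : vertex -> R) (v w x : vertex) :
  theta (u (shift v)) (u (shift w)) (u (shift x)) - theta (u v) (u w) (u x) =
  face_weight u v w x * (D1 u w - D1 u v) + face_weight u v x w * (D1 u x - D1 u v).
Proof.
  set (f := fun t => theta (path u t v) (path u t w) (path u t x)).
  set (k := fun w x t => coupling (path u t v) (path u t w) (path u t x)).
  assert (hk : forall w x, is_RInt (k w x) 0 1 (face_weight u v w x)).
  { intros w' x'; apply (RInt_correct (V := R_CompleteNormedModule)).
    apply ex_RInt_continuous; intros; apply continuous_coupling_path. }
  assert (h1 : is_RInt (fun t => k w x t * (D1 u w - D1 u v) + k x w t * (D1 u x - D1 u v))
      0 1 (f 1 - f 0)).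
  { apply (is_RInt_derive (V := R_CompleteNormedModule) f).
    - intros t _.
      exact (is_derive_theta (u v) (u w) (u x) (D1 u v) (D1 u w) (D1 u x) t).
    - intros t _.
      apply (continuous_plus (V := R_NormedModule));
        apply (continuous_scal_l (V := R_NormedModule));
        apply continuous_coupling_path. }
  assert (h2 : is_RInt (fun t => k w x t * (D1 u w - D1 u v) + k x w t * (D1 u x - D1 u v))
      0 1 (face_weight u v w x * (D1 u w - D1 u v) + face_weight u v x w * (D1 u x - D1 u v))).
  { apply (is_RInt_plus (V := R_NormedModule));
      (eapply is_RInt_ext; [intros; apply Rmult_comm |]; rewrite Rmult_comm;
       apply (is_RInt_scal (V := R_NormedModule)); apply hk). }
  rewrite <- (is_RInt_unique _ _ _ _ h2), (is_RInt_unique _ _ _ _ h1).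
  unfold f, path; f_equal; [| f_equal]; f_equal; ring.
Qed.

(** * Plane geometry of triangles near a common apex *)

Definition cis (a : R) : C := (cos a, sin a).

Lemma cis_plus (a b : R) : cis (a + b) = (cis a * cis b)%C.
Proof.
  unfold cis, Cmult; cbn [fst snd]; rewrite cos_plus, sin_plus.
  f_equal; ring.
Qed.

Lemma cis_2PI_plus (a : R) : cis (2 * PI + a) = cis a.
Proof. rewrite cis_plus; unfold cis at 1; rewrite cos_2PI, sin_2PI; apply Cmult_1_l. Qed.

Lemma interior_triangle (p q s : C) (a b : R) :
  ccw p q s -> 0 < a -> 0 < b -> a + b < 1 ->
  interior (triangle p q s) (p + RtoC a * (q - p) + RtoC b * (s - p))%C.
Proof.
  destruct p as [p1 p2], q as [q1 q2], s as [s1 s2]; unfold ccw; cbn [fst snd].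
  intros hdet ha hb hab.
  set (det := (q1 - p1) * (s2 - p2) - (q2 - p2) * (s1 - p1)) in *.
  set (z0 := (_ + _)%C).
  (* By Cramer's rule, [A] and [B] are the affine coordinates of a point along q - p and s - p. They
     are continuous, so the strict inequalities at [z0] persist in a neighborhood. *)
  set (A := fun z : C => ((fst z - p1) * (s2 - p2) - (snd z - p2) * (s1 - p1)) / det).
  set (B := fun z : C => ((q1 - p1) * (snd z - p2) - (q2 - p2) * (fst z - p1)) / det).
  assert (hA : A z0 = a).
  { unfold A, z0; cbn; unfold det; field; fold det; lra. }
  assert (hB : B z0 = b).
  { unfold B, z0; cbn; unfold det; field; fold det; lra. }
  assert (cf : continuous (fun z : C => fst z) z0) by apply continuous_fst.
  assert (cs : continuous (fun z : C => snd z) z0) by apply continuous_snd.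
  assert (cl : forall f : C -> R, continuous f z0 ->
    forall k, continuous (fun z => f z - k) z0).
  { intros f hf k; apply (continuous_minus (V := R_NormedModule));
      [exact hf | apply continuous_const]. }
  assert (cm : forall f : C -> R, continuous f z0 ->
    forall k, continuous (fun z => f z * k) z0).
  { intros f hf k; apply (continuous_scal_l (V := R_NormedModule)); exact hf. }
  assert (cA : continuous A z0).
  { apply cm, (continuous_minus (V := R_NormedModule)); apply cm, cl; assumption. }
  assert (cB : continuous B z0).
  { apply cm, (continuous_minus (V := R_NormedModule));
      (eapply continuous_ext; [intros; apply Rmult_comm |]); apply cm, cl; assumption. }
  assert (lA : locally z0 (fun z => 0 < A z)).
  { apply cA, open_gt; rewrite hA; exact ha. }
  assert (lB : locally z0 (fun z => 0 < B z)).
  { apply cB, open_gt; rewrite hB; exact hb. }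
  assert (lAB : locally z0 (fun z => A z + B z < 1)).
  { apply (continuous_plus (V := R_NormedModule) A B z0 cA cB (fun y => y < 1)).
    apply open_lt; rewrite hA, hB; exact hab. }
  unfold interior.
  apply (filter_imp (fun z => (0 < A z /\ 0 < B z) /\ A z + B z < 1)).
  2: { repeat apply filter_and; assumption. }
  intros z [[h1 h2] h3].
  exists (1 - A z - B z), (A z), (B z); repeat split; try lra.
  destruct z as [z1 z2]; unfold A, B, Cplus, Cmult, RtoC; cbn [fst snd].
  f_equal; unfold det; field; fold det; lra.
Qed.

(** The dot and cross products of e and f are a b cos th and a b sin th: the law of cosines gives
    the first, and positivity of the cross product fixes the sign of the sine. Hence f points in the
    direction of e turned counterclockwise by th. *)
Lemma angle_rotation (e f : C) (a b : R) :
  0 < a -> 0 < b -> Cmod e = a -> Cmod f = b ->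
  0 < fst e * snd f - snd e * fst f ->
  let th := angle_of_sides a b (Cmod (e - f)) in
  0 < th < PI /\ (f / RtoC b = e / RtoC a * cis th)%C.
Proof.
  intros ha hb he hf hc th.
  assert (sq : forall z, Cmod z ^ 2 = fst z * fst z + snd z * snd z).
  { intros z; unfold Cmod; rewrite pow2_sqrt; [ring | nra]. }
  pose proof (sq e) as e2; pose proof (sq f) as f2; pose proof (sq (e - f)%C) as ef2.
  rewrite he in e2; rewrite hf in f2.
  destruct e as [e1 e2'], f as [f1 f2']; cbn [fst snd Cminus Cplus Copp] in *.
  set (X := e1 * f2' - e2' * f1) in *.
  set (D := e1 * f1 + e2' * f2').
  assert (hXD : X * X + D * D = a ^ 2 * b ^ 2).
  { rewrite e2, f2; unfold X, D; ring. }
  assert (hab : 0 < a * b) by (apply Rmult_lt_0_compat; assumption).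
  assert (hth : th = acos (D / (a * b))).
  { unfold th, angle_of_sides; f_equal; rewrite e2, f2, ef2; unfold D; cbn; field; lra. }
  assert (hsq : (D / (a * b)) ^ 2 + (X / (a * b)) ^ 2 = 1).
  { transitivity ((X * X + D * D) / (a ^ 2 * b ^ 2)); [field; lra |].
    rewrite hXD; field; lra. }
  assert (hXp : 0 < X / (a * b)) by (apply Rdiv_lt_0_compat; assumption).
  assert (hlt : -1 < D / (a * b) < 1) by nra.
  assert (hcos : cos th = D / (a * b)) by (rewrite hth; apply cos_acos; lra).
  assert (hsin : sin th = X / (a * b)).
  { rewrite hth, sin_acos by lra.
    rewrite <- (sqrt_Rsqr (X / (a * b))) by lra; f_equal; unfold Rsqr; nra. }
  split.
  - rewrite hth; apply acos_bound_lt; exact hlt.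
  - unfold cis; rewrite hcos, hsin.
    (* The components follow from conj(e) f = D + i X, multiplied by e, with e conj(e) = a^2. *)
    assert (n2 : e1 * e1 + e2' * e2' = a * a) by lra.
    assert (rw : forall (z : C) (r : R), 0 < r -> (z / RtoC r)%C = (fst z / r, snd z / r)).
    { intros [z1 z2] r hr; unfold Cdiv, Cmult, Cinv, RtoC; cbn; f_equal; field; lra. }
    rewrite !rw by assumption; unfold Cmult; cbn [fst snd]; f_equal.
    + transitivity (f1 * (e1 * e1 + e2' * e2') / (a * a * b)).
      * rewrite n2; field; lra.
      * unfold D, X; field; lra.
    + transitivity (f2' * (e1 * e1 + e2' * e2') / (a * a * b)).
      * rewrite n2; field; lra.
      * unfold D, X; field; lra.
Qed.

(** A direction strictly inside the sector is a positive combination of its sides: sin th cis phi =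
    sin (th - phi) + sin phi cis th. Dividing by the side lengths gives the coefficients [a] and
    [b], and points at parameter t stay inside while t (a + b) < 1. *)
Lemma interior_triangle_ray (p d : C) (r s th phi : R) :
  0 < r -> 0 < s -> 0 < phi < th -> th < PI -> d <> 0%C ->
  exists delta, 0 < delta /\ forall t, 0 < t < delta ->
    interior (triangle p (p + RtoC r * d) (p + RtoC s * (d * cis th)))%C
      (p + RtoC t * (d * cis phi))%C.
Proof.
  intros hr hs hphi hth hd.
  assert (S0 : 0 < sin th) by (apply sin_gt_0; lra).
  assert (S1 : 0 < sin phi) by (apply sin_gt_0; lra).
  assert (S2 : 0 < sin (th - phi)) by (apply sin_gt_0; lra).
  assert (hrs : 0 < r * sin th) by (apply Rmult_lt_0_compat; assumption).
  assert (hss : 0 < s * sin th) by (apply Rmult_lt_0_compat; assumption).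
  set (a := sin (th - phi) / (r * sin th)).
  set (b := sin phi / (s * sin th)).
  assert (ha : 0 < a) by (apply Rdiv_lt_0_compat; assumption).
  assert (hb : 0 < b) by (apply Rdiv_lt_0_compat; assumption).
  exists (/ (a + b)); split; [apply Rinv_0_lt_compat; lra |].
  intros t [ht0 ht].
  assert (htab : t * (a + b) < 1).
  { apply Rmult_lt_reg_r with (/ (a + b)); [apply Rinv_0_lt_compat; lra |].
    rewrite Rmult_assoc, Rinv_r, Rmult_1_r, Rmult_1_l by lra; exact ht. }
  set (q := (p + RtoC r * d)%C); set (w := (p + RtoC s * (d * cis th))%C).
  replace (p + RtoC t * (d * cis phi))%C
    with (p + RtoC (t * a) * (q - p) + RtoC (t * b) * (w - p))%C.
  - apply interior_triangle; [| apply Rmult_lt_0_compat; lra | apply Rmult_lt_0_compat; lra | lra].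
    unfold q, w, ccw; destruct p as [p1 p2], d as [d1 d2].
    unfold cis, Cplus, Cmult, RtoC; cbn [fst snd].
    assert (hd2 : 0 < d1 * d1 + d2 * d2).
    { destruct (Req_dec d1 0) as [-> | h]; [destruct (Req_dec d2 0) as [-> | h] |]; try nra.
      exfalso; apply hd; reflexivity. }
    match goal with |- 0 < ?g =>
      replace g with ((d1 * d1 + d2 * d2) * r * (s * sin th)) by ring end.
    repeat apply Rmult_lt_0_compat; assumption.
  - unfold q, w, a, b; rewrite sin_minus.
    destruct p as [p1 p2], d as [d1 d2].
    unfold cis, Cminus, Copp, Cplus, Cmult, RtoC; cbn [fst snd].
    f_equal; field; lra.
Qed.

(** * Angle sum of a closed fan of triangles *)

Fixpoint partial_sum (th : nat -> R) (n : nat) : R :=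
  match n with O => 0 | S k => partial_sum th k + th k end.

(** The sides [e k] issue from the apex [p], and [th k] turns side k into side k + 1. Disjointness
    from the first triangle bounds the total by 2 pi; closing up makes it a multiple of 2 pi, and it
    is positive. *)
Lemma fan_angle_sum (p : C) (e : nat -> C) (rho th : nat -> R) (N : nat) :
  (forall k, 0 < rho k) ->
  (forall k, Cmod (e k) = rho k) ->
  (forall k, 0 < th k < PI) ->
  (forall k, e (S k) / RtoC (rho (S k)) = e k / RtoC (rho k) * cis (th k))%C ->
  (0 < N)%nat -> e N = e O ->
  (forall j, (0 < j < N)%nat -> forall z : C,
     ~ (interior (triangle p (p + e O) (p + e 1%nat)) z /\
        interior (triangle p (p + e j) (p + e (S j))) z)%C) ->
  partial_sum th N = 2 * PI.
Proof.
  intros hrho hmod hth hrot hN hper hdisj.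
  set (d := fun k => (e k / RtoC (rho k))%C).
  assert (he : forall k, e k = (RtoC (rho k) * d k)%C).
  { intros k; unfold d; field; intros h; injection h; specialize (hrho k); lra. }
  assert (hd : forall k, d k = (d O * cis (partial_sum th k))%C).
  { induction k as [| k IH]; cbn [partial_sum].
    - unfold cis; rewrite cos_0, sin_0; symmetry; apply Cmult_1_r.
    - unfold d at 1; rewrite hrot; fold (d k).
      rewrite IH, cis_plus; ring. }
  assert (hd0 : forall k, d k <> 0%C).
  { intros k h; specialize (hmod k); rewrite he, h, Cmult_0_r, Cmod_0 in hmod.
    specialize (hrho k); lra. }
  assert (hle : forall j, (j <= N)%nat -> partial_sum th j <= 2 * PI).
  { induction j as [| j IH]; cbn [partial_sum]; intros hj.
    - pose proof PI_RGT_0; lra.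
    - specialize (IH ltac:(lia)).
      destruct (Rle_dec (partial_sum th j + th j) (2 * PI)) as [h | h]; [exact h | exfalso].
      (* The first sector alone spans less than pi, so an overshoot occurs in a later one, to which
         [hdisj] applies. *)
      destruct j as [| j].
      { cbn in h; pose proof (hth O); lra. }
      set (Sj := partial_sum th (S j)) in *; set (tj := th (S j)) in *.
      (* The direction 2 pi + [ep] lies strictly inside the overshooting sector, and the same
         direction, as [ep], strictly inside the first one. *)
      set (ep := Rmin (th O) (Sj + tj - 2 * PI) / 2).
      assert (hep : 0 < ep /\ ep < th O /\ ep < Sj + tj - 2 * PI).
      { pose proof (hth O); unfold ep.
        pose proof (Rmin_l (th O) (Sj + tj - 2 * PI)).
        pose proof (Rmin_r (th O) (Sj + tj - 2 * PI)).
        assert (0 < Rmin (th O) (Sj + tj - 2 * PI)) by (apply Rmin_glb_lt; lra).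
        lra. }
      destruct (interior_triangle_ray p (d O) (rho O) (rho 1%nat) (th O) ep)
        as [t0 [ht0 h0]]; [apply hrho | apply hrho | lra | apply hth | apply hd0 |].
      destruct (interior_triangle_ray p (d (S j)) (rho (S j)) (rho (S (S j))) tj
        (2 * PI + ep - Sj)) as [t1 [ht1 h1]];
        [apply hrho | apply hrho | lra | apply hth | apply hd0 |].
      set (t := Rmin t0 t1 / 2).
      assert (ht : 0 < t /\ t < t0 /\ t < t1).
      { unfold t; pose proof (Rmin_l t0 t1); pose proof (Rmin_r t0 t1).
        assert (0 < Rmin t0 t1) by (apply Rmin_glb_lt; lra); lra. }
      specialize (h0 t ltac:(lra)); specialize (h1 t ltac:(lra)).
      assert (hz : (d (S j) * cis (2 * PI + ep - Sj))%C = (d O * cis ep)%C).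
      { rewrite hd; fold Sj; rewrite <- Cmult_assoc, <- cis_plus.
        replace (Sj + (2 * PI + ep - Sj)) with (2 * PI + ep) by ring.
        rewrite cis_2PI_plus; reflexivity. }
      rewrite hz in h1.
      refine (hdisj (S j) _ (p + RtoC t * (d O * cis ep))%C (conj _ _)); [lia | |].
      + rewrite (he O), (he 1%nat); unfold d at 2; rewrite hrot; exact h0.
      + rewrite (he (S j)), (he (S (S j))); unfold d at 2; rewrite hrot; exact h1. }
  assert (hpos : forall j, (0 < j)%nat -> 0 < partial_sum th j).
  { intros [| j] hj; [lia |]; clear hj; induction j as [| j IH].
    - cbn; pose proof (hth O); lra.
    - change (0 < partial_sum th (S j) + th (S j)); pose proof (hth (S j)); lra. }
  specialize (hle N (le_n N)); specialize (hpos N hN).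
  set (T := partial_sum th N) in *.
  assert (hdN : d N = d O).
  { unfold d; rewrite <- (hmod N), <- (hmod O), hper; reflexivity. }
  assert (hT : cis T = 1%C).
  { rewrite hd in hdN; fold T in hdN.
    transitivity ((d O * cis T) / d O)%C; [field; apply hd0 |].
    rewrite hdN; field; apply hd0. }
  (* For 0 < T < 2 pi one has sin (T / 2) > 0, so cos T = 1 - 2 sin^2 (T / 2) < 1, against cis T =
     1. *)
  destruct (Rlt_dec T (2 * PI)) as [h | h]; [exfalso | lra].
  injection hT as hc _.
  assert (0 < sin (T / 2)) by (apply sin_gt_0; lra).
  replace T with (2 * (T / 2)) in hc by field.
  rewrite cos_2a_sin in hc; nra.
Qed.

(** * Combinatorics of the hexagonal lattice *)

(** [hexdir k] is e^{k pi i / 3} in the basis (1, e^{pi i / 3}). *)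
Fixpoint hexdir (k : nat) : Z * Z :=
  match k with
  | O => (1, 0)%Z
  | S k => (- snd (hexdir k), fst (hexdir k) + snd (hexdir k))%Z
  end.

(** The neighbors are listed counterclockwise for all natural [k], with period 6, so the predecessor
    of index [k] is written [5 + k]. *)
Definition nbr (v : vertex) (k : nat) : vertex :=
  (fst v + fst (hexdir k), snd v + snd (hexdir k))%Z.

Lemma nbr_add_6 (v : vertex) (k : nat) : nbr v (6 + k) = nbr v k.
Proof. unfold nbr; cbn; f_equal; ring. Qed.

Lemma shift_nbr (v : vertex) (k : nat) : shift (nbr v k) = nbr (shift v) k.
Proof. unfold shift, nbr; cbn; f_equal; ring. Qed.

Lemma neighbors_nbr (v : vertex) : neighbors v = map (nbr v) (seq 0 6).
Proof.
  destruct v as [m n]; unfold neighbors, nbr; cbn.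
  repeat (apply f_equal2; [f_equal; ring |]); reflexivity.
Qed.

Lemma hexdir_norm (k : nat) :
  let (a, b) := hexdir k in (a * a + a * b + b * b = 1)%Z.
Proof.
  induction k as [| k IH]; [reflexivity | cbn].
  destruct (hexdir k) as [a b]; cbn; rewrite <- IH; ring.
Qed.

Lemma adj_sym (v w : vertex) : adj v w <-> adj w v.
Proof. rewrite !adj_norm_form; cbn; split; intros h; rewrite <- h; ring. Qed.

Lemma adj_nbr (v : vertex) (k : nat) : adj v (nbr v k).
Proof.
  rewrite adj_norm_form; unfold nbr; cbn.
  pose proof (hexdir_norm k) as h; destruct (hexdir k) as [a b]; cbn.
  rewrite <- h; ring.
Qed.

Lemma adj_nbr_nbr (v : vertex) (j k : nat) :
  adj (nbr v j) (nbr v k) <-> adj (hexdir j) (hexdir k).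
Proof.
  rewrite !adj_norm_form; unfold nbr; cbn [fst snd].
  split; intros h; rewrite <- h; ring.
Qed.

(** The basis (1, e^{pi i / 3}) has determinant sqrt 3 / 2 > 0, so orientation can be read off from
    the integer coordinates. *)
Lemma ccw_pos (v x y : vertex) :
  (0 < (fst x - fst v) * (snd y - snd v) - (snd x - snd v) * (fst y - fst v))%Z ->
  ccw (pos v) (pos x) (pos y).
Proof.
  destruct v as [v1 v2], x as [x1 x2], y as [y1 y2]; unfold ccw, pos; cbn [fst snd].
  intros h; apply IZR_lt in h; rewrite minus_IZR, !mult_IZR, !minus_IZR in h.
  rewrite cos_PI3, sin_PI3; cbn.
  assert (hs : 0 < sqrt 3) by (apply sqrt_lt_R0; lra).
  match type of h with 0 < ?d =>
    match goal with |- 0 < ?g => replace g with (sqrt 3 / 2 * d) by field end end.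
  apply Rmult_lt_0_compat; [lra | exact h].
Qed.

Lemma positive_face_nbr (v : vertex) (k : nat) :
  positive_face v (nbr v k) (nbr v (S k)).
Proof.
  split; [split; [apply adj_nbr | split] |].
  - rewrite adj_nbr_nbr, adj_norm_form; cbn.
    pose proof (hexdir_norm k) as h; destruct (hexdir k) as [a b]; cbn.
    rewrite <- h; ring.
  - apply adj_sym, adj_nbr.
  (* The determinant of (a, b) and its rotation (-b, a + b) is the norm form a^2 + a b + b^2 = 1. *)
  - apply ccw_pos; unfold nbr; cbn.
    pose proof (hexdir_norm k) as h; destruct (hexdir k) as [a b]; cbn; lia.
Qed.

Lemma sum_over_perm (l l' : list vertex) (f : vertex -> R) :
  Permutation l l' -> sum_over l f = sum_over l' f.
Proof.
  unfold sum_over; induction 1; cbn in *; lra.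
Qed.

Lemma adj_nbr_inv (v w : vertex) : adj v w -> exists k, (k < 6)%nat /\ w = nbr v k.
Proof.
  rewrite <- neighbors_spec, neighbors_nbr, in_map_iff.
  intros [k [<- hk]]; apply in_seq in hk; exists k; split; [lia | reflexivity].
Qed.

Lemma third_vertices_nbr (v : vertex) (k : nat) : (k < 6)%nat ->
  Permutation (third_vertices v (nbr v k)) [nbr v (5 + k); nbr v (S k)].
Proof.
  intros hk; apply NoDup_Permutation.
  - apply third_vertices_NoDup.
  - constructor; [| repeat constructor; cbn; tauto].
    intros [h | []]; unfold nbr in h; injection h; intros h1 h2; clear h.
    pose proof (hexdir_norm k) as h; cbn in *; destruct (hexdir k) as [a b]; cbn in *.
    nia.
  - intros x; rewrite third_vertices_spec by apply adj_nbr; split.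
    + intros [_ [h1 h2]]; apply adj_sym, adj_nbr_inv in h2; destruct h2 as [j [hj ->]].
      rewrite adj_nbr_nbr, adj_norm_form in h1.
      (* A finite check of the 36 index pairs: only j = k - 1 and j = k + 1 modulo 6 give adjacent
         neighbors. *)
      do 6 (destruct k as [| k]; [do 6 (destruct j as [| j];
        [cbn in h1; first [discriminate h1 | left; reflexivity | right; left; reflexivity]
        |]); lia |]); lia.
    + assert (hf : forall j, face v (nbr v j) (nbr v (S j))) by apply positive_face_nbr.
      intros [<- | [<- | []]].
      * destruct (hf (5 + k)%nat) as [h1 [h2 h3]].
        change (S (5 + k)) with (6 + k)%nat in *; rewrite nbr_add_6 in *.
        repeat split; apply adj_sym; assumption.
      * apply hf.
Qed.

Lemma third_vertices_sym (v w : vertex) :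
  adj v w -> Permutation (third_vertices v w) (third_vertices w v).
Proof.
  intros h; apply NoDup_Permutation; try apply third_vertices_NoDup.
  intros x; rewrite !third_vertices_spec by (assumption || apply adj_sym, h).
  unfold face; rewrite (adj_sym v w), (adj_sym w x), (adj_sym x v); tauto.
Qed.

(** * The edge weights as sums of two face weights *)

Lemma eta_face_weight (u : vertex -> R) (v w : vertex) :
  eta u v w = sum_over (third_vertices v w) (face_weight u v w).
Proof.
  unfold eta, sum_over; f_equal; apply map_ext; intros x.
  apply RInt_ext; intros; apply dtheta_coupling.
Qed.

Lemma eta_nbr (u : vertex -> R) (v : vertex) (k : nat) : (k < 6)%nat ->
  eta u v (nbr v k) =
  face_weight u v (nbr v k) (nbr v (5 + k)) + face_weight u v (nbr v k) (nbr v (S k)).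
Proof.
  intros hk; rewrite eta_face_weight, (sum_over_perm _ _ _ (third_vertices_nbr v k hk)).
  unfold sum_over; cbn [map fold_right]; ring.
Qed.

Lemma eta_sym (u : vertex -> R) (v w : vertex) : adj v w -> eta u v w = eta u w v.
Proof.
  intros h; rewrite !eta_face_weight, (sum_over_perm _ _ _ (third_vertices_sym v w h)).
  unfold sum_over; f_equal; apply map_ext; intros; apply face_weight_sym.
Qed.

Lemma eta_bounds (u : vertex -> R) (v w : vertex) : adj v w -> 0 < eta u v w < 2.
Proof.
  intros h; apply adj_nbr_inv in h; destruct h as [k [hk ->]].
  rewrite eta_nbr by exact hk.
  pose proof (face_weight_bounds u v (nbr v k) (nbr v (5 + k))).
  pose proof (face_weight_bounds u v (nbr v k) (nbr v (S k))).
  lra.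
Qed.

Lemma nbr_distinct (v : vertex) (j : nat) : (0 < j < 6)%nat -> nbr v 0 <> nbr v j.
Proof.
  intros hj h; unfold nbr in h; injection h; intros h1 h2.
  destruct j as [| [| [| [| [| [| j]]]]]]; cbn in *; lia.
Qed.

(** * Angle sums of the packing and harmonicity *)

Definition flower_angle (u : vertex -> R) (v : vertex) (k : nat) : R :=
  theta (u v) (u (nbr v k)) (u (nbr v (S k))).

Lemma flower_angle_sum (P : vertex -> circle) (v : vertex) :
  circle_packing P -> locally_univalent P ->
  partial_sum (flower_angle (log_radius P) v) 6 = 2 * PI.
Proof.
  intros [htan hor] hU.
  set (e := fun k => (center (P (nbr v k)) - center (P v))%C).
  set (rho := fun k => radius (P v) + radius (P (nbr v k))).
  assert (hrho : forall k, 0 < rho k).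
  { intros k; pose proof (radius_pos (P v)); pose proof (radius_pos (P (nbr v k))).
    unfold rho; lra. }
  assert (hmod : forall k, Cmod (e k) = rho k).
  { intros k; unfold e, rho; rewrite Rplus_comm.
    apply (htan (nbr v k) v), adj_sym, adj_nbr. }
  assert (hrot : forall k, 0 < flower_angle (log_radius P) v k < PI /\
    (e (S k) / RtoC (rho (S k)) =
     e k / RtoC (rho k) * cis (flower_angle (log_radius P) v k))%C).
  { intros k.
    (* By tangency, the side lengths in [theta] are the distances between the centers, so [theta] is
       the actual angle between consecutive sides of the fan. *)
    replace (flower_angle (log_radius P) v k)
      with (angle_of_sides (rho k) (rho (S k)) (Cmod (e k - e (S k)))).
    - apply angle_rotation; try apply hrho; try apply hmod.
      apply (hor _ _ _ (positive_face_nbr v k)).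
    - unfold flower_angle, theta, log_radius; rewrite !exp_ln by apply radius_pos.
      unfold rho; f_equal.
      replace (e k - e (S k))%C with (center (P (nbr v k)) - center (P (nbr v (S k))))%C
        by (unfold e; ring).
      apply (htan _ _), (positive_face_nbr v k). }
  assert (he : forall k, (center (P v) + e k)%C = center (P (nbr v k))).
  { intros k; unfold e; ring. }
  apply (fan_angle_sum (center (P v)) e rho); try assumption.
  - apply hrot.
  - apply hrot.
  - lia.
  - unfold e; change (nbr v 6) with (nbr v (6 + 0)); rewrite (nbr_add_6 v 0); reflexivity.
  - intros j hj z; rewrite !he.
    apply hU; try apply positive_face_nbr.
    intros h; apply (nbr_distinct v j hj); congruence.
Qed.

Theorem lemma4p3 (P : vertex -> circle)
  (hP : circle_packing P) (hU : locally_univalent P) :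
  let u := log_radius P in
  discrete_harmonic (eta u) (D1 u) /\
  (forall v w : vertex, adj v w ->
     eta u v w = eta u w v /\ 0 < eta u v w /\ eta u v w < 2).
Proof.
  intros u; split.
  2: { intros v w h; split; [apply eta_sym, h | apply eta_bounds, h]. }
  intros v.
  pose proof (flower_angle_sum P v hP hU) as h0.
  pose proof (flower_angle_sum P (shift v) hP hU) as h1.
  fold u in h0, h1.
  (* Translation commutes with taking the k-th neighbor, so each angle at [shift v] is compared with
     the corresponding angle at [v]. *)
  assert (hd : forall k, flower_angle u (shift v) k = flower_angle u v k +
    (face_weight u v (nbr v k) (nbr v (S k)) * (D1 u (nbr v k) - D1 u v) +
     face_weight u v (nbr v (S k)) (nbr v k) * (D1 u (nbr v (S k)) - D1 u v))).
  { intros k; unfold flower_angle; rewrite <- !shift_nbr, <- theta_shift_sub; ring. }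
  unfold partial_sum in h0, h1; rewrite !hd in h1.
  rewrite neighbors_nbr; unfold sum_over; cbn [seq map fold_right].
  rewrite !eta_nbr by lia; cbn [Nat.add].
  (* Indices 6 to 10 are reduced modulo 6. The difference of the two angle sums then contains, for
     each neighbor, the weights of both faces at its edge, which together form [eta]. *)
  pose proof (nbr_add_6 v) as h6; cbn [Nat.add] in h6.
  rewrite (h6 4%nat), (h6 3%nat), (h6 2%nat), (h6 1%nat), (h6 0%nat).
  rewrite (h6 0%nat) in h1.
  lra.
Qed.
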